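(* Let $n\ge 1$, $k\ge 2$ be integers, $t>k-1$ a real number, $p\in\Delta^{k-1}$, and let $\hat p_{k,n}$ be the empirical probability vector of a multinomial sample with $n$ trials and probability vector $p$. Let $$\hat\lambda_{k,n}:=\min\left\{1-\frac{k-1}{t}+\frac{k}{k-1}\,\frac{t-k+1}{n},\ 1\right\}.$$ Then $$\mathbb{P}\left(n\,\mathcal{D}(\hat p_{k,n}\|p)>t\right)\le\exp(-\hat\lambda_{k,n}t)\,G_{k,n}(\hat\lambda_{k,n}).$$
   Context: $\Delta^{k-1}=\{p\in\mathbb{R}^k: p_i\ge 0,\ \sum_{i=1}^k p_i=1\}$. If $(X_1,\dots,X_k)$ is multinomial with $n$ trials and probability vector $p$, then $\hat p_{k,n}=(X_1/n,\dots,X_k/n)$. The relative entropy is $\mathcal{D}(\hat p\|p)=\sum_{i=1}^k\hat p_i\log(\hat p_i/p_i)$ with natural logarithm and conventions $0\cdot\log(0)=0$, $0\cdot\log(0/0)=0$. For integers $k,n\ge1$, $p\in\Delta^{k-1}$ and $\lambda\in[0,1]$, $$G_{k,n}(\lambda,p):=\sum_{X_1,\dots,X_k}\binom{n}{X_1,\dots,X_k}\prod_{i=1}^k\left[\lambda X_i/n+(1-\lambda)p_i\right]^{X_i},$$ where the sum is over non-negative integers with $X_1+\dots+X_k=n$, and $0^0=1$. This value does not depend on $p\in\Delta^{k-1}$; the common value is denoted $G_{k,n}(\lambda)$. *)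

(* Defs.v *)
From HB Require Import structures.
From mathcomp Require Import all_boot all_order all_algebra.
From mathcomp Require Import all_classical all_reals all_analysis.

Set Implicit Arguments.
Unset Strict Implicit.
Unset Printing Implicit Defensive.

Import Order.TTheory GRing.Theory Num.Theory.

Local Open Scope classical_set_scope.
Local Open Scope ring_scope.

Definition simplex (R : realType) (k : nat) : set 'rV[R]_k :=
  [set p | (forall i, 0 <= p 0 i) /\ \sum_(i < k) p 0 i = 1].

Definition multinomial_coef (R : realType) (k n : nat) (x : 'I_k -> nat) : R :=
  (n`!)%:R / (\prod_(i < k) (x i)`!)%N%:R.

Definition multinomial_pmf (R : realType) (k n : nat) (p : 'rV[R]_k)
    (x : 'I_k -> nat) : R :=
  if (\sum_(i < k) x i)%N == n
  then multinomial_coef R n x * \prod_(i < k) p 0 i ^+ x i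
  else 0.

Definition is_multinomial (R : realType) (d : measure_display)
    (T : measurableType d) (P : probability T R) (k n : nat) (p : 'rV[R]_k)
    (X : 'I_k -> {RV P >-> nat}) : Prop :=
  forall x : 'I_k -> nat,
    P [set w | forall i, X i w = x i] = (multinomial_pmf n p x)%:E.

Definition empirical (R : realType) (k n : nat) (x : 'I_k -> nat) : 'rV[R]_k :=
  \row_(i < k) ((x i)%:R / n%:R).

(* One summand a * log (a / b) of the relative entropy: it is 0 when a = 0,
   whatever b, and +oo when a > 0 = b.  Since [ln] and division are total on R,
   both conventions have to be imposed explicitly. *)
Definition rel_entropy_term (R : realType) (a b : R) : \bar R :=
  if a == 0 then 0%E else if b == 0 then +oo%E else (a * ln (a / b))%:E.

Definition rel_entropy (R : realType) (k : nat) (q p : 'rV[R]_k) : \bar R :=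
  (\sum_(i < k) rel_entropy_term (q 0%R i) (p 0%R i))%E.

(* $G_{k,n}(\lambda,p)$; the entries of a k-tuple of naturals of sum n are at
   most n, so the sum runs over functions into 'I_n.+1, and 0 ^+ 0 = 1. *)
Definition Gp (R : realType) (k n : nat) (lambda : R) (p : 'rV[R]_k) : R :=
  \sum_(x : {ffun 'I_k -> 'I_n.+1} | (\sum_(i < k) x i)%N == n)
    multinomial_coef R n (fun i => x i) *
    \prod_(i < k) (lambda * (x i)%:R / n%:R + (1 - lambda) * p 0 i) ^+ x i.

(* $G_{k,n}(\lambda)$, the common value of $G_{k,n}(\lambda,p)$ for p in the
   simplex: for k > 0 the set below is a singleton and [xget] returns its
   element. *)
Definition G (R : realType) (k n : nat) (lambda : R) : R :=
  xget 0 [set g : R | forall p : 'rV[R]_k, simplex p -> Gp n lambda p = g].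

Definition lambda_hat (R : realType) (k n : nat) (t : R) : R :=
  Num.min (1 - (k%:R - 1) / t + k%:R / (k%:R - 1) * ((t - k%:R + 1) / n%:R)) 1.

(* Main.v *)
Require Import Defs.
From HB Require Import structures.
From mathcomp Require Import all_boot all_order all_algebra.
From mathcomp Require Import all_classical all_reals all_analysis.

Import Order.TTheory GRing.Theory Num.Theory.

Local Open Scope classical_set_scope.
Local Open Scope ring_scope.

(** The bound is a Chernoff bound whose exponential moment is estimated by the
    weighted inequality between arithmetic and geometric means.  Write l for
    lambda_hat, which lies in [0, 1] because t > k - 1.

    For a sample x with n D(x/n || p) > t, multiplying its likelihood by
    exp (l (n D - t)) >= 1 replaces each factor p_i ^ x_i by
    ((x_i/n) ^ l p_i ^ (1 - l)) ^ x_i, up to the global constant exp (- l t),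
    and the geometric mean is at most l x_i/n + (1 - l) p_i
    ([likelihood_le_mixture], from the convexity of exp).  Samples at which
    the relative entropy is infinite have likelihood 0.  Summing over all x
    gives exp (- l t) G_{k,n}(l, p).  The event {n D > t} is reduced to such a
    finite sum in [multinomial_event_le]: the tuples whose sum is not n form a
    countable union of null events.

    It remains to see that G_{k,n}(l, p) is the same for all p in the simplex,
    so that it equals G_{k,n}(l).  With a = l/n and b_i = (1 - l) p_i, it is n!
    times the coefficient of z^n in the product over i of the exponential
    generating functions f_b(z) = sum_m (b + a m)^m z^m / m! at b = b_i, so it
    is enough that f_x f_y depends only on x + y, which is Abel's and Cauchy's
    identity ([abel_conv_line]).  That is proved by induction on the order of
    the coefficient: moving x up and y down at equal speed, the derivative of
    the coefficient of order n + 1 is the coefficient of order n at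
    (x + a, y) minus the one at (x, y + a), and these agree since both have
    sum x + y + a. *)

(** * Abel polynomials and Cauchy's convolution identity *)

Lemma deriv_eq0_polyC (R : numDomainType) (q : {poly R}) :
  q^`() = 0 -> q = (q.[0])%:P.
Proof.
move=> dq; apply/polyP => -[|i]; rewrite coefC ?horner_coef0 //=.
have := congr1 (fun r : {poly R} => r`_i) dq.
by rewrite coef_deriv coef0 => /eqP; rewrite mulrn_eq0 => /eqP.
Qed.

Lemma coef_prod_poly (R : comNzRingType) (k n : nat) (c : 'I_k -> nat -> R) :
  (\prod_(i < k) \poly_(m < n.+1) c i m)`_n =
  \sum_(x : {ffun 'I_k -> 'I_n.+1} | (\sum_(i < k) x i)%N == n)
     \prod_(i < k) c i (x i).
Proof.
under eq_bigr => i _ do rewrite poly_def.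
rewrite bigA_distr_bigA coef_sum /= [RHS]big_mkcond; apply: eq_bigr => x _.
rewrite scaler_prod prodrXr coefZ coefXn eq_sym.
by case: eqP; rewrite ?mulr1 ?mulr0.
Qed.

Section Abel.
Variables (R : numFieldType) (a : R).

(** The normalisation by m! makes this an Appell-like family: differentiation
    lowers the degree by one and shifts the argument by a. *)
Definition abel_poly (m : nat) : {poly R} :=
  (m`!%:R^-1) *: ('X + (a * m%:R)%:P) ^+ m.

Lemma horner_abel_poly m x :
  (abel_poly m).[x] = (x + a * m%:R) ^+ m / m`!%:R.
Proof. by rewrite /abel_poly !hornerE mulrC. Qed.

Lemma deriv_abel_poly m : (abel_poly m.+1)^`() = abel_poly m \Po ('X + a%:P).
Proof.
rewrite /abel_poly derivZ deriv_exp derivD derivX derivC addr0 mul1r /=.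
rewrite comp_polyZ rmorphXn /= comp_polyD comp_polyX comp_polyC.
rewrite -scaler_nat scalerA factS natrM invfM mulrAC.
rewrite mulVf ?pnatr_eq0 // mul1r -addrA -polyCD.
by rewrite -nat1r mulrDr mulr1.
Qed.

Lemma deriv_abel_poly_comp m (u : {poly R}) :
  (abel_poly m.+1 \Po u)^`() = (abel_poly m \Po (u + a%:P)) * u^`().
Proof.
rewrite deriv_comp deriv_abel_poly -comp_polyA.
by rewrite comp_polyD comp_polyX comp_polyC.
Qed.

Lemma abel_poly0_comp u : abel_poly 0 \Po u = 1.
Proof. by rewrite /abel_poly expr0 fact0 invr1 scale1r comp_polyC. Qed.

(** The arguments are polynomials so that both can move along a line, and the
    derivative in the parameter of that line is formal. *)
Definition abel_conv (n : nat) (u v : {poly R}) : {poly R} :=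
  \sum_(j < n.+1) (abel_poly j \Po u) * (abel_poly (n - j) \Po v).

Lemma deriv_abel_conv n u v :
  (abel_conv n.+1 u v)^`() = abel_conv n (u + a%:P) v * u^`()
                             + abel_conv n u (v + a%:P) * v^`().
Proof.
rewrite /abel_conv raddf_sum.
under eq_bigr => j _ do rewrite /= derivM.
rewrite big_split /=; congr (_ + _).
  (* The term of index 0 is constant in u; the others reindex to order n. *)
  rewrite big_ord_recl abel_poly0_comp -polyC1 derivC mul0r add0r mulr_suml.
  by apply: eq_bigr => j _; rewrite /= deriv_abel_poly_comp mulrAC.
rewrite big_ord_recr /= subnn abel_poly0_comp -polyC1 derivC mulr0 addr0.
rewrite mulr_suml.
apply: eq_bigr => j _; rewrite /= subSn ?deriv_abel_poly_comp ?mulrA //.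
by rewrite -ltnS.
Qed.

(** Cauchy's identity: the convolution is constant along a line of constant sum.
    By [deriv_abel_conv] its derivative there is a difference of two
    convolutions of lower order, on lines with the same sum x + y + a, which
    the induction hypothesis identifies.  The constant is read off at the point
    where the arguments are x + y and 0. *)
Lemma abel_conv_line n x y :
  abel_conv n ('X + x%:P) (y%:P - 'X) =
  (\sum_(j < n.+1) (abel_poly j).[x + y] * (abel_poly (n - j)).[0])%:P.
Proof.
elim: n x y => [|n IHn] x y.
  rewrite /abel_conv !big_ord1 !abel_poly0_comp !horner_abel_poly !expr0.
  by rewrite fact0 invr1 !mulr1.
set q := abel_conv _ _ _.
have qE z : q.[z] = \sum_(j < n.+2) (abel_poly j).[z + x]
                                     * (abel_poly (n.+1 - j)).[y - z].
  rewrite /q /abel_conv horner_sum; apply: eq_bigr => j _.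
  by rewrite hornerM !horner_comp !(hornerD, hornerN, hornerX, hornerC).
have dq : q^`() = 0.
  rewrite /q deriv_abel_conv -addrA -polyCD addrAC -polyCD !IHn.
  rewrite derivD derivB derivX !derivC addr0 sub0r mulr1 mulrN1.
  by rewrite addrAC addrA subrr.
have qC := deriv_eq0_polyC _ _ dq.
rewrite qC; have -> : q.[0] = q.[y] by rewrite qC !hornerC.
by rewrite qE subrr addrC.
Qed.

(** The exponential generating function f_b of the values (b + a m)^m, cut at
    degree n: identities between such series hold up to degree n only. *)
Definition abel_series (n : nat) (b : R) : {poly R} :=
  \poly_(m < n.+1) (abel_poly m).[b].

Lemma coef_abel_seriesM n m x y : (m <= n)%N ->
  (abel_series n x * abel_series n y)`_m =
  (abel_series n (x + y) * abel_series n 0)`_m.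
Proof.
move=> lemn.
have coefE u v : (abel_series n u * abel_series n v)`_m =
    \sum_(j < m.+1) (abel_poly j).[u] * (abel_poly (m - j)).[v].
  rewrite coefM; apply: eq_bigr => j _; rewrite !coef_poly.
  by rewrite !ltnS (leq_trans (leq_subr _ _)) // (leq_trans _ lemn) // -ltnS.
rewrite !coefE.
have /(congr1 (horner^~ 0)) := abel_conv_line m x y.
rewrite hornerC /abel_conv horner_sum => <-; apply: eq_bigr => j _.
rewrite hornerM !horner_comp !(hornerD, hornerN, hornerX, hornerC).
by rewrite add0r oppr0 addr0.
Qed.

(** Repeated use of f_x f_y = f_(x+y) f_0 gathers all the parameters into a
    single factor, so that the product depends only on their sum.  With f_c kept
    apart, the exponent of f_0 is the length of s, also when s is empty. *)
Lemma coef_prod_abel_series (I : Type) (s : seq I) (b : I -> R) n c m :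
  (m <= n)%N ->
  (abel_series n c * \prod_(i <- s) abel_series n (b i))`_m =
  (abel_series n (c + \sum_(i <- s) b i) * abel_series n 0 ^+ size s)`_m.
Proof.
elim: s c m => [|i s IHs] c m lemn; first by rewrite !big_nil addr0 mulr1.
rewrite !big_cons mulrA addrA exprSr mulrA.
transitivity (abel_series n (c + b i) * abel_series n 0
               * \prod_(j <- s) abel_series n (b j))`_m.
  rewrite !coefM; apply: eq_bigr => j _; rewrite coef_abel_seriesM //.
  by rewrite (leq_trans _ lemn) // -ltnS.
rewrite mulrAC !coefM; apply: eq_bigr => j _.
by rewrite IHs // (leq_trans _ lemn) // -ltnS.
Qed.

End Abel.

(** * Independence of G from the probability vector *)

Lemma Gp_abel_series (R : realType) (k n : nat) (lambda : R) (p : 'rV[R]_k) :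
  Gp n lambda p = n`!%:R *
    (\prod_(i < k) abel_series _ (lambda / n%:R) n ((1 - lambda) * p 0 i))`_n.
Proof.
rewrite /Gp coef_prod_poly mulr_sumr; apply: eq_bigr => x _.
rewrite /multinomial_coef natr_prod -mulrA -prodfV -big_split /=.
congr (_ * _); apply: eq_bigr => i _.
by rewrite horner_abel_poly mulrC addrC [lambda / _ * _]mulrAC.
Qed.

(** After the parameters (1 - lambda) p_i have been gathered, p enters only
    through their sum 1 - lambda. *)
Lemma Gp_simplex (R : realType) (k n : nat) (lambda : R) (p q : 'rV[R]_k) :
  simplex p -> simplex q -> Gp n lambda p = Gp n lambda q.
Proof.
case: k p q => [p q [_]|k p q [_ p1] [_ q1]].
  by rewrite big_ord0 => /esym/eqP; rewrite oner_eq0.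
rewrite !Gp_abel_series !big_ord_recl !coef_prod_abel_series //.
by rewrite -!mulr_sumr -!mulrDr -!(big_ord_recl _ (fun i => _ 0 i)) p1 q1.
Qed.

Lemma G_eq (R : realType) (k n : nat) (lambda : R) (p : 'rV[R]_k) :
  simplex p -> G k n lambda = Gp n lambda p.
Proof.
move=> hp; apply: xget_unique => [q hq|g /(_ p hp) -> //].
exact: Gp_simplex.
Qed.

(** * Events of a multinomial sample *)

Section MultinomialEvent.
Context (R : realType) (d : measure_display) (T : measurableType d).
Context (P : probability T R) (k n : nat) (p : 'rV[R]_k).
Variable X : 'I_k -> {RV P >-> nat}.

Lemma measurable_RV_eq (x : 'I_k -> nat) :
  measurable [set w | forall i, X i w = x i].
Proof.
have -> : [set w | forall i, X i w = x i] =
    \bigcap_(i in [set: 'I_k]) (X i @^-1` [set x i]).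
  by apply/seteqP; split=> w /= Xw i; [move=> _ |]; exact: Xw.
apply: fin_bigcap_measurable => // i _.
by rewrite -[X in measurable X]setTI; exact: measurable_funPT.
Qed.

(** Tuples of naturals are countably many, so every event determined by X is a
    countable union of atoms. *)
Lemma measurable_RV_event (E : ('I_k -> nat) -> Prop) :
  measurable [set w | E (fun i => X i w)].
Proof.
pose F (x : {ffun 'I_k -> nat}) :=
  [set w | forall i, X i w = x i] `&` [set _ | E x].
have -> : [set w | E (fun i => X i w)] = \bigcup_x F x.
  apply/seteqP; split=> w /=.
    move=> Ew; exists [ffun i => X i w] => //; split=> [i|] /=.
      by rewrite ffunE.
    by congr E: Ew; apply/funext => i; rewrite ffunE.
  move=> [x _ [Xw Ex]]; congr E: Ex; apply/funext => i; exact/esym/Xw.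
apply: countable_bigcupT_measurable => [|x]; first exact: countableP.
apply: measurableI; first exact: measurable_RV_eq.
have [Ex|nEx] := pselect (E x).
  by rewrite (_ : [set _ | _] = setT) //; apply/seteqP; split.
by rewrite (_ : [set _ | _] = set0) //; apply/seteqP; split.
Qed.

Hypothesis hX : is_multinomial n p X.

(** The point probabilities vanish on tuples with another sum; enumerating the
    countably many tuples avoids showing that the remaining ones sum to 1. *)
Lemma negligible_multinomial_sum :
  P.-negligible [set w | (\sum_(i < k) X i w)%N <> n].
Proof.
pose F (m : nat) := if unpickle m is Some x then
    if (\sum_(i < k) (x : {ffun 'I_k -> nat}) i)%N == n then set0
    else [set w | forall i, X i w = x i] else set0.
apply: (@negligibleS _ _ _ _ (\bigcup_m F m)); last first.
  apply: negligible_bigcup => m; rewrite /F.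
  case: unpickle => [x|]; last exact: negligible_set0.
  case: ifPn => [_|/negPf sx]; first exact: negligible_set0.
  apply/negligibleP; first exact: measurable_RV_eq.
  by apply: etrans (hX x) _; rewrite /multinomial_pmf sx.
move=> w /= /eqP/negPf sw; exists (pickle [ffun i => X i w]) => //.
rewrite /F pickleK; under eq_bigr do rewrite ffunE.
by rewrite sw => i; rewrite ffunE.
Qed.

(** Off a null set the sample has sum n, hence entries at most n, and the event
    is covered by finitely many atoms. *)
Lemma multinomial_event_le (E : ('I_k -> nat) -> Prop) :
  (P [set w | E (fun i => X i w)] <=
   (\sum_(x : {ffun 'I_k -> 'I_n.+1} |
          ((\sum_(i < k) x i)%N == n) && `[< E (fun i => x i) >])
      multinomial_pmf n p (fun i => x i))%:E)%E.
Proof.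
have [N [mN N0 sN]] := negligible_multinomial_sum.
pose A := \big[setU/set0]_(x : {ffun 'I_k -> 'I_n.+1} |
    ((\sum_(i < k) x i)%N == n) && `[< E (fun i => x i) >])
  [set w | forall i, X i w = x i].
have [mA leA] : measurable A /\ (P A <= (\sum_(x : {ffun 'I_k -> 'I_n.+1} |
          ((\sum_(i < k) x i)%N == n) && `[< E (fun i => x i) >])
      multinomial_pmf n p (fun i => x i))%:E)%E.
  rewrite /A -sumEFin.
  elim/big_ind2: _ => [|B1 b1 B2 b2 [mB1 le1] [mB2 le2]|x _].
  - by rewrite measure0.
  - split; first exact: measurableU.
    by apply: le_trans (leeD le1 le2); exact: measureU2.
  - by rewrite -hX; split => //; exact: measurable_RV_eq.
rewrite (le_trans _ leA) // -(measureU0 mA mN N0) le_measure ?inE //.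
- exact: measurable_RV_event.
- exact: measurableU.
move=> w /= Ew; have [sw|/sN] := pselect ((\sum_(i < k) X i w)%N = n);
  last by right.
left; pose x : {ffun 'I_k -> 'I_n.+1} := [ffun i => inord (X i w)].
have xE : (fun i => x i : nat) = (fun i => X i w).
  apply/funext => i; rewrite /x ffunE inordK // ltnS -[leqRHS]sw (bigD1 i) //=.
  exact: leq_addr.
rewrite /A (bigD1 x) /=; first by left => i; have := congr1 (@^~ i) xE.
apply/andP; split; last by apply/asboolP; rewrite xE.
by apply/eqP; rewrite -[RHS]sw; apply: eq_bigr => i _;
  have := congr1 (@^~ i) xE.
Qed.
End MultinomialEvent.

(** * The pointwise exponential bound *)

(** The geometric mean a^l b^(1-l), in the form in which it arises from the
    relative entropy.  This is convexity of exp between ln (a / b) and 0. *)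
Lemma geom_mean_le (R : realType) (l a b : R) : 0 <= l <= 1 -> 0 < a -> 0 < b ->
  b * expR (l * ln (a / b)) <= l * a + (1 - l) * b.
Proof.
move=> /andP[l0 l1] a0 b0.
have := convex_expR (Itv01 l0 l1) (ln (a / b)) 0.
rewrite !convRE /= mulr0 addr0 expR0 mulr1 lnK ?posrE ?divr_gt0 //.
rewrite -(ler_pM2l b0) => /le_trans; apply.
by rewrite mulrDr mulrCA [b * (a / b)]mulrC divfK ?gt_eqF // [b * _]mulrC.
Qed.

(** The Chernoff step, sample by sample: after multiplication by
    exp (lambda (n D - t)) >= 1 each likelihood factor becomes a geometric mean
    of x_i / n and p_i, bounded by the arithmetic one. *)
Lemma likelihood_le_mixture (R : realType) (k n : nat) (lambda t : R)
    (p : 'rV[R]_k) (x : 'I_k -> nat) :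
  (0 < n)%N -> 0 <= lambda <= 1 -> (forall i, 0 <= p 0 i) ->
  (t%:E < n%:R%:E * rel_entropy (empirical R n x) p)%E ->
  \prod_(i < k) p 0 i ^+ x i <= expR (- lambda * t) *
    \prod_(i < k) (lambda * (x i)%:R / n%:R + (1 - lambda) * p 0 i) ^+ x i.
Proof.
move=> n0 l01 p0; have /andP[l0 l1] := l01.
have nR0 : (0 : R) < n%:R by rewrite ltr0n.
have mean_ge0 i : 0 <= lambda * (x i)%:R / n%:R + (1 - lambda) * p 0 i.
  by rewrite addr_ge0 // ?divr_ge0 ?mulr_ge0 // subr_ge0.
(* A coordinate with x_i > 0 = p_i makes the entropy infinite and the
   likelihood zero; elsewhere the entropy is a finite real sum. *)
have [[i [xi pi]] _|nsing] := pselect (exists i, (0 < x i)%N /\ p 0 i = 0).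
  rewrite (bigD1 i) //= pi expr0n gtn_eqF // mul0r.
  by rewrite mulr_ge0 ?expR_ge0 // prodr_ge0 // => j _; exact: exprn_ge0.
have pos i : (0 < x i)%N -> 0 < p 0 i.
  by move=> xi; rewrite lt0r p0 andbT; apply/eqP => pi; apply: nsing; exists i.
have -> : rel_entropy (empirical R n x) p =
    (\sum_(i < k) (x i)%:R / n%:R * ln ((x i)%:R / n%:R / p 0 i))%:E.
  rewrite /rel_entropy -sumEFin; apply: eq_bigr => i _.
  rewrite /rel_entropy_term mxE; case: (posnP (x i)) => [->|xi].
    by rewrite !mul0r eqxx.
  by rewrite !gt_eqF ?pos // divr_gt0 // ltr0n.
rewrite -EFinM lte_fin mulr_sumr => ltD.
(* The right-hand side is exp (lambda (n D - t)), factored over coordinates. *)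
have /ler_wpM2l : 1 <= expR (- lambda * t) * \prod_(i < k)
    expR (lambda * ln ((x i)%:R / n%:R / p 0 i)) ^+ x i.
  under eq_bigr => i _ do rewrite -expRM_natl.
  rewrite -expR_sum -expRD -[leLHS]expR0 ler_expR addrC mulNr subr_ge0.
  have -> : \sum_(i < k) (x i)%:R * (lambda * ln ((x i)%:R / n%:R / p 0 i)) =
     lambda * \sum_(i < k)
       n%:R * ((x i)%:R / n%:R * ln ((x i)%:R / n%:R / p 0 i)).
    rewrite mulr_sumr; apply: eq_bigr => i _.
    by rewrite [n%:R * _]mulrA [n%:R * (_ / _)]mulrC divfK ?gt_eqF // mulrCA.
  by rewrite ler_wpM2l // ltW.
move=> /(_ (\prod_(i < k) p 0 i ^+ x i)); rewrite mulr1.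
move=> /(_ _)/le_trans; apply.
  by apply: prodr_ge0 => i _; exact: exprn_ge0.
rewrite mulrCA ler_wpM2l ?expR_ge0 // -big_split /=.
apply: ler_prod => i _; rewrite -exprMn exprn_ge0 ?mulr_ge0 ?expR_ge0 //=.
case: (posnP (x i)) => [->|xi]; first by rewrite !expr0.
rewrite lerXn2r ?nnegrE ?mulr_ge0 ?expR_ge0 //.
rewrite -[lambda * _ / _]mulrA; apply: geom_mean_le => //; last exact: pos.
by rewrite divr_gt0 // ltr0n.
Qed.

Lemma lambda_hat_itv (R : realType) (k n : nat) (t : R) :
  (2 <= k)%N -> k%:R - 1 < t -> 0 <= lambda_hat k n t <= 1.
Proof.
move=> k2 kt; have k1 : (0 : R) < k%:R - 1 by rewrite subr_gt0 ltr1n.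
have t0 := lt_trans k1 kt.
rewrite /lambda_hat ge_min lexx orbT andbT le_min ler01 andbT addr_ge0 //.
  by rewrite subr_ge0 ler_pdivrMr // mul1r ltW.
rewrite mulr_ge0 ?divr_ge0 ?(ltW k1) //.
by rewrite -addrA [- _ + 1]addrC -opprB subr_ge0 ltW.
Qed.

Lemma multinomial_coef_ge0 (R : realType) (k n : nat) (x : 'I_k -> nat) :
  0 <= multinomial_coef R n x.
Proof. by rewrite divr_ge0. Qed.

Theorem corollary2 (R : realType) (n k : nat) (hn : (1 <= n)%N) (hk : (2 <= k)%N)
    (t : R) (ht : k%:R - 1 < t) (p : 'rV[R]_k) (hp : simplex p)
    (d : measure_display) (T : measurableType d) (P : probability T R)
    (X : 'I_k -> {RV P >-> nat}) (hX : is_multinomial n p X) :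
  (P [set w | t%:E < n%:R%:E *
                rel_entropy (empirical R n (fun i => X i w)) p]
   <= (expR (- lambda_hat k n t * t) * G k n (lambda_hat k n t))%:E)%E.
Proof.
have l01 := lambda_hat_itv _ _ n _ hk ht; have [p0 _] := hp.
apply: le_trans (multinomial_event_le _ _ _ _ _ _ _ _ hX
  (fun x => (t%:E < n%:R%:E * rel_entropy (empirical R n x) p)%E)) _.
rewrite lee_fin (G_eq _ _ _ _ _ hp) /Gp mulr_sumr big_mkcondr /=.
apply: ler_sum => x sx; rewrite /multinomial_pmf sx mulrCA.
case: asboolP => [tx|_].
  by rewrite ler_wpM2l ?multinomial_coef_ge0 //; exact: likelihood_le_mixture.
have /andP[l0 l1] := l01.
rewrite !mulr_ge0 ?multinomial_coef_ge0 ?expR_ge0 // prodr_ge0 // => i _.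
by rewrite exprn_ge0 // addr_ge0 // ?divr_ge0 ?mulr_ge0 // subr_ge0.
Qed.
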